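(* Let $S$ be a closed symmetric relation in a Hilbert space $\mathfrak H$ with equal defect numbers, let $\Gamma^{(1)}=\{\mathcal H,\Gamma_0^{(1)},\Gamma_1^{(1)}\}$ be an ordinary boundary triplet for $S^*$, and let $W$ be a unitary relation from $(\mathcal H^2,J_{\mathcal H})$ to $(\widetilde{\mathcal H}^2,J_{\widetilde{\mathcal H}})$, where $\widetilde{\mathcal H}$ is a Hilbert space, such that $\ker W=\{0\}$. Then the linear relation $$\Gamma^{(2)}=W\Gamma^{(1)}\qquad( * )$$ is a boundary relation for $S^*$. Conversely, for every boundary relation $\Gamma^{(2)}:\mathfrak H^2\to\widetilde{\mathcal H}^2$ for $S^*$ there exists a unitary relation $W$ from $(\mathcal H^2,J_{\mathcal H})$ to $(\widetilde{\mathcal H}^2,J_{\widetilde{\mathcal H}})$ with $\ker W=\{0\}$ such that $\Gamma^{(2)}$ is recovered from $\Gamma^{(1)}$ via $( * )$. In particular, formula $( * )$ establishes a bijective correspondence between the set of all boundary relations for $S^*$ with the fixed parameter space $\mathcal H$ and the set of all unitary relations $W$ in $(\mathcal H^2,J_{\mathcal H})$ with $\ker W=\{0\}$.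
   Context: A linear relation from $\mathfrak H_1$ to $\mathfrak H_2$ is a linear subspace of $\mathfrak H_1\times\mathfrak H_2$; operators are identified with graphs; products of relations are defined by composition. For a Hilbert space $\mathcal H$, $\mathcal H^2=\mathcal H\oplus\mathcal H$ is a Kreĭn space $(\mathcal H^2,J_{\mathcal H})$ with fundamental symmetry $J_{\mathcal H}=\begin{pmatrix}0&-iI\\ iI&0\end{pmatrix}$, i.e. $[\widehat h,\widehat k]=(J_{\mathcal H}\widehat h,\widehat k)=-i[(h',k)-(h,k')]$. A linear relation $W$ between Kreĭn spaces is unitary if $W^{-1}=W^{[*]}$, where $W^{[*]}$ is the adjoint with respect to the indefinite inner products (unitary relations may be multivalued, unbounded, nondensely defined). Boundary relation: for a closed symmetric linear relation $S$ in $\mathfrak H$, a linear relation $\Gamma:\mathfrak H^2\to\mathcal H^2$ is a boundary relation for $S^*$ if (G1) $\operatorname{dom}\Gamma$ is dense in $S^*$ and $(f',g)_{\mathfrak H}-(f,g')_{\mathfrak H}=(h',k)_{\mathcal H}-(h,k')_{\mathcal H}$ for all $\{\widehat f,\widehat h\},\{\widehat g,\widehat k\}\in\Gamma$ (with $\widehat f=\{f,f'\}$ etc.); (G2) every $\{\widehat g,\widehat k\}\in\mathfrak H^2\times\mathcal H^2$ satisfying this identity for all $\{\widehat f,\widehat h\}\in\Gamma$ belongs to $\Gamma$. $\mathcal H$ is called the parameter space. Ordinary boundary triplet for $S^*$ (where $n_+(S)=n_-(S)$): a triplet $\{\mathcal H,\Gamma_0,\Gamma_1\}$ with $\mathcal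 H$ a Hilbert space, $\dim\mathcal H=n_\pm(S)$, and $\Gamma_0,\Gamma_1$ bounded linear operators from $S^*$ (with the graph inner product) to $\mathcal H$ such that $(f',g)-(f,g')=(\Gamma_1\widehat f,\Gamma_0\widehat g)_{\mathcal H}-(\Gamma_0\widehat f,\Gamma_1\widehat g)_{\mathcal H}$ for all $\widehat f,\widehat g\in S^*$ and $\widehat f\mapsto\{\Gamma_0\widehat f,\Gamma_1\widehat f\}$ maps $S^*$ onto $\mathcal H^2$. The triplet is identified with the operator $\Gamma=\{\Gamma_0,\Gamma_1\}:S^*\to\mathcal H^2$. *)

(* Defs.v *)
From HB Require Import structures.
From mathcomp Require Import all_boot all_order all_algebra.
From mathcomp Require Import sesquilinear complex.
From mathcomp Require Import boolp classical_sets functions cardinality.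
From mathcomp Require Import reals topology normedtype.

Set Implicit Arguments.
Unset Strict Implicit.
Unset Printing Implicit Defensive.

Import Order.TTheory GRing.Theory Num.Theory.
Import numFieldNormedType.Exports.

Local Open Scope classical_set_scope.
Local Open Scope ring_scope.

(* Complex Hilbert spaces; the inner product is linear in its first argument.
   On a product [E * F] the library norm is the maximum norm, which is only
   equivalent to the norm of the orthogonal sum. The topology of [E * F] is
   therefore the right one, but metric and inner-product notions on orthogonal
   sums go through [dot2] below. *)
HB.mixin Record CompleteNormedModule_isHilbert (R : realType) H
    of CompleteNormedModule R[i] H := {
  dot : {dot H for @Num.conj R[i]} ;
  sqr_norm_dot : forall x : H, `|x| ^+ 2 = dot x x
}.

#[short(type="hilbertType")]
HB.structure Definition Hilbert (R : realType) :=
  {H of CompleteNormedModule R[i] H & CompleteNormedModule_isHilbert R H}.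

Section Relations.
Context {C : nzRingType}.

Definition linear_subspace {V : lmodType C} (A : set V) : Prop :=
  A 0 /\ forall (a : C) x y, A x -> A y -> A (a *: x + y).

(* A relation from E to F is a set of pairs; composition and inversion are those
   of [relation_scope], in which [B \; A] means "first A, then B". *)
Definition linear_relation {E F : lmodType C} (T : set (E * F)) : Prop :=
  linear_subspace T.

Definition rel_dom {E F : Type} (T : set (E * F)) : set E := fst @` T.

Definition rel_ker {E F : lmodType C} (T : set (E * F)) : set E :=
  [set x | T (x, 0)].

Definition rel_adjoint {E F : Type} (formE : E -> E -> C) (formF : F -> F -> C)
    (T : set (E * F)) : set (F * E) :=
  [set kh | forall fg, T fg -> formF fg.2 kh.1 = formE fg.1 kh.2].

End Relations.

Section HilbertSpaces.
Context {R : realType}.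
Local Notation C := R[i].

Definition dot2 {H : hilbertType R} (x y : H * H) : C :=
  dot x.1 y.1 + dot x.2 y.2.

Definition fund_sym {H : hilbertType R} (x : H * H) : H * H :=
  (- ('i : C) *: x.2, ('i : C) *: x.1).

Definition krein {H : hilbertType R} (x y : H * H) : C := dot2 (fund_sym x) y.

Definition unitary_relation {H K : hilbertType R}
    (W : set ((H * H) * (K * K))) : Prop :=
  linear_relation W /\ (W^-1)%relation = rel_adjoint krein krein W.

Definition orthonormal_set {H : hilbertType R} (B : set H) : Prop :=
  forall x y, B x -> B y -> dot x y = (x == y)%:R.

Definition closed_span {H : hilbertType R} (B : set H) : set H :=
  smallest [set A | linear_subspace A /\ closed A] B.

(* Equality of the Hilbert dimensions (cardinalities of orthonormal bases) of
   two closed subspaces. *)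
Definition same_dim {H K : hilbertType R} (N : set H) (M : set K) : Prop :=
  exists (A : set H) (B : set K),
    [/\ orthonormal_set A, closed_span A = N,
        orthonormal_set B, closed_span B = M & (A #= B)%card].

Section BoundaryRelations.
Context {H : hilbertType R}.
Implicit Type S : set (H * H).

Definition adj S : set (H * H) := rel_adjoint dot dot S.

Definition closed_symmetric S : Prop :=
  [/\ linear_relation S, closed S & S `<=` adj S].

(* ker (S^* - z); the defect numbers of S are the dimensions of these spaces at
   z = 'i and z = - 'i. *)
Definition defect_space S (z : C) : set H := [set f | adj S (f, z *: f)].

Definition equal_defect_numbers S : Prop :=
  same_dim (defect_space S 'i) (defect_space S (- 'i)).

Definition green_identity {K : hilbertType R} (x y : (H * H) * (K * K)) : Prop :=
  dot x.1.2 y.1.1 - dot x.1.1 y.1.2 = dot x.2.2 y.2.1 - dot x.2.1 y.2.2.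

Definition boundary_relation {K : hilbertType R} S
    (G : set ((H * H) * (K * K))) : Prop :=
  [/\ linear_relation G,
      rel_dom G `<=` adj S,
      adj S `<=` closure (rel_dom G),
      forall x y, G x -> G y -> green_identity x y
    & forall y, (forall x, G x -> green_identity x y) -> G y].

Definition linear_on {K : hilbertType R} (A : set (H * H)) (g : H * H -> K) :
    Prop :=
  forall (a : C) x y, A x -> A y -> g (a *: x + y) = a *: g x + g y.

Definition graph_norm (x : H * H) : C := sqrtC (dot2 x x).

Definition bounded_for_graph_norm {K : hilbertType R} (A : set (H * H))
    (g : H * H -> K) : Prop :=
  exists M : C, forall x, A x -> `|g x| <= M * graph_norm x.

(* The boundary maps are total functions of which only the values on S^* matter:
   neither this record nor [triplet_rel] depends on the other values. *)
Record ordinary_boundary_triplet (K : hilbertType R) S (G0 G1 : H * H -> K) :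
    Prop := {
  triplet_dim_pos : same_dim [set: K] (defect_space S 'i) ;
  triplet_dim_neg : same_dim [set: K] (defect_space S (- 'i)) ;
  triplet_linear0 : linear_on (adj S) G0 ;
  triplet_linear1 : linear_on (adj S) G1 ;
  triplet_bounded0 : bounded_for_graph_norm (adj S) G0 ;
  triplet_bounded1 : bounded_for_graph_norm (adj S) G1 ;
  triplet_green : forall f g, adj S f -> adj S g ->
    dot f.2 g.1 - dot f.1 g.2 = dot (G1 f) (G0 g) - dot (G0 f) (G1 g) ;
  triplet_onto : forall h : K * K, exists2 f, adj S f & (G0 f, G1 f) = h
}.

Definition triplet_rel {K : hilbertType R} S (G0 G1 : H * H -> K) :
    set ((H * H) * (K * K)) :=
  [set x | adj S x.1 /\ x.2 = (G0 x.1, G1 x.1)].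

End BoundaryRelations.

End HilbertSpaces.

(* Main.v *)
From HB Require Import structures.
Require Import Defs.
From mathcomp Require Import all_boot all_order all_algebra.
From mathcomp Require Import sesquilinear complex.
From mathcomp Require Import boolp classical_sets functions cardinality.
From mathcomp Require Import reals topology normedtype.
From mathcomp Require Import prodnormedzmodule ring.

Set Implicit Arguments.
Unset Strict Implicit.
Unset Printing Implicit Defensive.

Import Order.TTheory GRing.Theory Num.Theory.
Import numFieldNormedType.Exports.
Local Open Scope classical_set_scope.
Local Open Scope ring_scope.

(** On [H * H] consider the form [sympl (x, x') (y, y') = (x', y) - (x, y')]; it is
    nondegenerate, skew-Hermitian, and proportional to the indefinite inner
    product [krein]; the adjoint of a relation is its [sympl]-orthogonal
    complement. Equip [(H * H) * (K * K)] with the difference of the two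
    symplectic forms. A unitary relation is then a linear subspace equal to its
    own orthogonal complement ([unitary_lagrangian]), and a boundary relation for
    [S^*] is such a subspace whose domain is a dense part of [S^*]
    ([boundary_lagrangian]).

    The triplet map [Gamma = (G0, G1)] carries the symplectic form of [S^*] onto
    the one of [K * K], and its kernel is [S] ([triplet_ker]): the form on [S^*]
    degenerates exactly on [S^**], which is [S]. So [Gamma] is a symplectic
    reduction with isotropic part [S], and transporting self-orthogonal subspaces
    along it, in either direction, is linear algebra. Surjectivity of [Gamma]
    lets [W] be recovered from [W Gamma], whence the bijection.

    What remains is to match [ker W = {0}] with density of the domain. Put
    [T = dom (W Gamma)]. If [g] belongs to [T^*], then [g] belongs to [S^*] and
    [Gamma g] is orthogonal to [dom W], so [(Gamma g, 0)] lies in the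
    self-orthogonal [W]. Trivial kernel thus forces [g] into [ker Gamma = S], and
    since [T^*] lies in [S], taking adjoints puts [S^*] inside [T^**], that is, in the
    closure of [T]. Conversely, an [f] with [Gamma f] in [ker W] is orthogonal to
    a dense part of [S^*], hence belongs to [S^** = S], and [Gamma f = 0].

    The one analytic ingredient is that [T^**] lies in the closure of [T]
    ([biadjoint_sub_closure]), which comes from orthogonal projection onto a
    closed subspace ([orthogonal_separation]). The projection is proved for a
    positive definite form whose norm is merely equivalent to the given complete
    norm, because [H * H] carries the maximum norm. *)

(** * Positive definite forms *)

Section DotForms.
Context {C : numClosedFieldType} {U : lmodType C}.
Implicit Types (f : {dot U for @Num.conj C}) (u v a : U).

Lemma dot_conjC f u v : f u v = (f v u)^*.
Proof. by have := hermC f u v; rewrite expr0 mul1r. Qed.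

Lemma parallelogram f u v :
  f (u + v) (u + v) + f (u - v) (u - v) = (f u u + f v v) *+ 2.
Proof. by rewrite dnormD dnormB addrACA subrr addr0 mulr2n. Qed.

Lemma dot_CauchySchwarz f u v : `|f u v| ^+ 2 <= f u u * f v v.
Proof.
have [->|v0] := eqVneq v 0; first by rewrite !linear0r normr0 expr0n mulr0.
have fv0 : f v v != 0 by rewrite dnorm_eq0.
pose t := f u v / f v v; pose w := u - t *: v.
have wv : f w v = 0 by rewrite linearBl /= linearZl_LR /= divfK ?subrr.
have -> : f u u = f w w + `|t| ^+ 2 * f v v.
  have wtv : f w (t *: v) = 0 by rewrite linearZr_LR /= wv mulr0.
  by rewrite -dnormZ -[u in LHS](subrK (t *: v)) dnormD wtv conjC0 !addr0.
have -> : f u v = t * f v v by rewrite divfK.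
rewrite normrM (ger0_norm (dnorm_ge0 _ _)) exprMn mulrDl (expr2 (f v v)) mulrA.
by rewrite lerDr mulr_ge0 ?dnorm_ge0.
Qed.

(** First-order condition at an approximate minimizer: a vector [u] whose square
    cannot be lowered by [e] along the direction [a] is nearly orthogonal to [a].
    The step [t = (u, a) / (1 + (a, a))] gives the bound without a case
    distinction on [a = 0]. *)
Lemma near_minimizer_orthogonal f u a (e : C) :
  (forall t, f u u - e < f (u - t *: a) (u - t *: a)) ->
  `|f u a| ^+ 2 < e * (1 + f a a).
Proof.
set c := f u a => umin.
have q0 : 0 <= f a a by rewrite dnorm_ge0.
have Q0 : 0 < 1 + f a a by rewrite ltr_pwDl.
pose s := (1 + f a a)^-1.
have s0 : 0 < s by rewrite invr_gt0.
have := umin (s * c).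
have -> : f (u - (s * c) *: a) (u - (s * c) *: a) =
          f u u - s * `|c| ^+ 2 * (2 - s * f a a).
  rewrite dnormB dnormZ linearZr_LR /= -/c !rmorphM /= !conjCK.
  rewrite (CrealP (gtr0_real s0)) normrM (gtr0_norm s0) !normCK.
  rewrite -addrA; congr (_ + _).
  rewrite !mulrBr exprMn normCK; move: (c^*) => d.
  by ring.
rewrite ltrD2l ltrN2 => le_e.
rewrite -ltr_pdivrMr// mulrC -/s; apply: le_lt_trans le_e.
rewrite ler_peMr ?mulr_ge0 ?exprn_ge0 ?normr_ge0 ?(ltW s0)//.
by rewrite lerBrDr -[2]/(1 + 1) lerD2l /s mulrC ler_pdivrMr// mul1r lerDr ler01.
Qed.

End DotForms.

(** * Infima and completeness *)

Section ComplexInfimum.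
Context {R : realType}.
Local Notation C := R[i].

(** Norms and inner products take values in [R[i]], whose order is partial; this
    transfers infima from [R] so that no real parts appear later. *)
Lemma complex_nneg_inf (P : set C) : P !=set0 -> (forall x, P x -> 0 <= x) ->
  exists d : C, (forall x, P x -> d <= x) /\
    (forall e, 0 < e -> exists2 x, P x & x < d + e).
Proof.
move=> [x0 Px0] P0.
have Re_ge0 (x : C) : 0 <= x -> x = (complex.Re x)%:C%C /\ 0 <= complex.Re x.
  by case: x => a b; rewrite lecE /= => /andP[/eqP -> ->].
pose D : set R := [set complex.Re x | x in P].
have D0 : has_inf D.
  split; first by exists (complex.Re x0); exists x0.
  by exists 0 => _ [x Px <-]; apply: (Re_ge0 _ (P0 _ Px)).2.
exists (inf D)%:C%C; split.
  move=> x Px; rewrite (Re_ge0 _ (P0 _ Px)).1 lecR.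
  by apply: ge_inf; [exact: D0.2|exists x].
move=> e e0; have [eE _] := Re_ge0 _ (ltW e0).
have e1 : 0 < complex.Re e by rewrite -ltcR -eE.
have [_ [x Px <-] xlt] := inf_adherent e1 D0.
by exists x => //; rewrite eE (Re_ge0 _ (P0 _ Px)).1 -rmorphD ltcR.
Qed.

End ComplexInfimum.

Lemma cauchy_image (T U : uniformType) (h : T -> U) (F : set_system T) :
  Filter F -> unif_continuous h -> cauchy F -> cauchy (h @ F).
Proof.
move=> FF hU Fc A /hU /Fc[[P Q] /= [FP FQ] PQ]; exists (h @` P, h @` Q).
  split=> /=; first by apply: filterS FP => p Pp; exists p.
  by apply: filterS FQ => q Qq; exists q.
by move=> [_ _] /= [[p Pp <-] [q Qq <-]]; apply: (PQ (p, q)).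
Qed.

Section ProductComplete.
Context {T U : completeType}.

HB.instance Definition _ := Pointed.on (T * U)%type.

Lemma prod_complete (F : set_system (T * U)) :
  ProperFilter F -> cauchy F -> [cvg F in (T * U)%type].
Proof.
move=> FF Fc.
have Fc1 : cauchy (fst @ F).
  apply: cauchy_image Fc => A entA.
  by apply: filterS (prod_entP entA (@entourageT U)) => p [].
have Fc2 : cauchy (snd @ F).
  apply: cauchy_image Fc => A entA.
  by apply: filterS (prod_entP (@entourageT T) entA) => p [].
apply/cvg_ex; exists (lim (fst @ F), lim (snd @ F)).
move=> A [[P Q] /= [P1 Q2] PQA].
have FP : F (fst @^-1` P) by exact: cauchy_cvg Fc1 _ P1.
have FQ : F (snd @^-1` Q) by exact: cauchy_cvg Fc2 _ Q2.
by apply: filterS (filterI FP FQ) => p; exact: PQA.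
Qed.

HB.instance Definition _ := Uniform_isComplete.Build (T * U)%type prod_complete.

End ProductComplete.

HB.instance Definition _ (K : numFieldType) (V W : completeNormedModType K) :=
  Complete.on (V * W)%type.

(** * Orthogonal projection *)

Section Projection.
Context {R : realType} {E : completeNormedModType R[i]}.
Local Notation C := R[i].
Variables (f : {dot E for @Num.conj C}) (c : C).
Hypothesis c0 : 0 <= c.
Hypothesis lb : forall x, `|x| ^+ 2 <= f x x.
Hypothesis ub : forall x, f x x <= c * `|x| ^+ 2.

Lemma dot_continuous_left a : continuous (f^~ a : E -> C^o).
Proof.
move=> x; apply/cvgrPdist_lt => e e0.
pose M := 1 + c * f a a.
have M0 : 0 < M by rewrite ltr_pwDl// mulr_ge0 ?dnorm_ge0.
have eM0 : 0 < sqrtC (e ^+ 2 / M) by rewrite sqrtC_gt0 divr_gt0 ?exprn_gt0.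
near=> y.
have xy : `|x - y| < sqrtC (e ^+ 2 / M).
  by near: y; apply: cvgr_dist_lt => //; apply: cvg_id.
suff: `|f (x - y) a| < e by rewrite linearBl.
rewrite -(@ltr_pXn2r _ 2)// ?nnegrE ?(ltW e0)//.
apply: le_lt_trans (dot_CauchySchwarz _ _ _) _.
have : `|x - y| ^+ 2 < e ^+ 2 / M.
  by rewrite -[X in _ < X]sqrtCK ltr_pXn2r// nnegrE// ltW.
rewrite ltr_pdivlMr//; apply: le_lt_trans.
rewrite mulrDr mulr1 -[X in X <= _]add0r lerD ?exprn_ge0//.
by rewrite mulrA ler_wpM2r ?dnorm_ge0// mulrC ub.
Unshelve. all: by end_near. Qed.

Lemma closed_orthogonal w : closed [set x | f x w = 0].
Proof.
have -> : [set x | f x w = 0] = (f^~ w : E -> C^o) @^-1` [set 0] by [].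
apply: closed_comp => [x _|]; first exact: dot_continuous_left.
exact: (accessible_closed_set1 (hausdorff_accessible (@norm_hausdorff _ _))).
Qed.

(** The separating vector is [v - l], where [l] is the point of the closure of [A]
    nearest to [v] for the form [f]. *)
Lemma orthogonal_separation (A : set E) v :
  linear_subspace A -> ~ closure A v ->
  exists w, (forall a, A a -> f a w = 0) /\ f v w != 0.
Proof.
move=> [A0 Alin] nAv.
have AD x y t : A x -> A y -> A (x + t *: y).
  by move=> Ax Ay; rewrite addrC; apply: Alin.
pose q a := f (v - a) (v - a).
have [||d [dmin dinf]] := @complex_nneg_inf R (q @` A).
- by exists (q 0); exists 0.
- by move=> _ [a _ <-]; rewrite dnorm_ge0.
pose near_min e := [set a | A a /\ q a < d + e].
(* Near-minimizers are close to each other: by the parallelogram law applied to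
   [v - y] and [v - x], whose half-sum is [v - m] with [m] the midpoint. *)
have near_min_diam e x y : near_min e x -> near_min e y ->
    `|x - y| ^+ 2 < e *+ 4.
  move=> [Ax qx] [Ay qy]; apply: le_lt_trans (lb _) _.
  have := parallelogram f (v - y) (v - x).
  have -> : v - y - (v - x) = x - y by rewrite opprB addrC subrKA.
  pose m := 2^-1 *: (x + y).
  have Am : A m.
    rewrite /m scalerDr; apply: (Alin _ _ _ Ax).
    by rewrite -[_ *: y]addr0; apply: Alin.
  have -> : v - y + (v - x) = 2 *: (v - m).
    rewrite scalerBr scalerA mulfV ?pnatr_eq0// scale1r scaler_nat mulr2n.
    by rewrite addrACA opprD [- x - y]addrC.
  rewrite dnormZ normr_nat -natrX => /(canRL (addKr _)) ->.
  have dm : d <= q m by apply: dmin; exists m.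
  rewrite addrC ltrBlDr; apply: lt_le_trans (_ : (d + e) *+ 4 <= _).
    by rewrite [X in _ < X](mulrnA _ 2 2) ltrMn2r// mulr2n ltrD.
  by rewrite mulrnDl addrC lerD2l mulr_natl lerMn2r.
have near_min_orth e x a : near_min e x -> A a ->
    `|f (v - x) a| ^+ 2 < e * (1 + f a a).
  move=> [Ax qx] Aa; apply: near_minimizer_orthogonal => t.
  rewrite -addrA -opprD ltrBlDr; apply: lt_le_trans qx _.
  by rewrite lerD2r; apply: dmin; exists (x + t *: a) => //; apply: AD.
pose F : set_system E := filter_from [set e : C | 0 < e] near_min.
have FF : ProperFilter F.
  apply: filter_from_proper; last first.
    by move=> e /dinf [_ [a Aa <-] qa]; exists a.
  apply: filter_from_filter; first by exists 1; exact: ltr01.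
  move=> e1 e2 e10 e20.
  have [le12|le21] := real_leP (gtr0_real e10) (gtr0_real e20).
    exists e1 => // a [Aa qa]; split; split=> //.
    by apply: lt_le_trans qa _; rewrite lerD2l.
  exists e2 => // a [Aa qa]; split; split=> //.
  by apply: lt_trans qa _; rewrite ltrD2l.
have FA e : 0 < e -> F (near_min e) by move=> e0; exists e.
have cF : cauchy F.
  apply: cauchy_exP => e e0; pose e' := e ^+ 2 / 4%:R.
  have e'0 : 0 < e' by rewrite divr_gt0 ?exprn_gt0.
  have [x xe] := filter_ex (FA _ e'0); exists x.
  apply: filterS (FA _ e'0) => y ye.
  rewrite -ball_normE /ball_ /= -(@ltr_pXn2r _ 2)// ?nnegrE ?(ltW e0)//.
  by have := near_min_diam _ _ _ xe ye; rewrite -mulr_natr divfK ?pnatr_eq0.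
pose l := lim F.
have Fl : F --> l by exact: cauchy_cvg cF.
have Al : closure A l.
  move=> B /Fl FB; have [x [[Ax _] Bx]] := filter_ex (filterI (FA _ ltr01) FB).
  by exists x.
(* Along [F] the numbers [f (v - x) a] tend both to [f (v - l) a] and to [0]. *)
have lA a : A a -> f (v - l) a = 0.
  move=> Aa; apply: (@cvg_unique C^o (@norm_hausdorff _ _)
    (fmap (fun x => f (v - x) a) F)).
    apply: (@cvg_comp _ _ _ (fun x : E => v - x) (f^~ a : E -> C^o) F
      (nbhs (v - l))); last exact: dot_continuous_left.
    exact: (cvgB (cvg_cst v) Fl).
  apply/cvgrPdist_lt => e e0.
  have M0 : 0 < 1 + f a a by rewrite ltr_pwDl ?dnorm_ge0.
  have e'0 : 0 < e ^+ 2 / (1 + f a a) by rewrite divr_gt0 ?exprn_gt0.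
  apply: filterS (FA _ e'0) => x /near_min_orth/(_ Aa).
  rewrite divfK ?gt_eqF// sub0r normrN.
  by rewrite ltr_pXn2r// nnegrE// ltW.
have fw0 x : closure A x -> f x (v - l) = 0.
  suff: closure A `<=` [set x | f x (v - l) = 0] by apply.
  rewrite closureE; apply: smallest_sub; first exact: closed_orthogonal.
  by move=> a /lA fa; rewrite /= dot_conjC fa conjC0.
exists (v - l); split; first by move=> a /subset_closure /fw0.
rewrite -[v in f v _](subrK l) linearDl /= (fw0 _ Al) addr0 dnorm_eq0 subr_eq0.
by apply: contra_notN nAv => /eqP ->.
Qed.

End Projection.

(** * The orthogonal sum of a Hilbert space with itself *)

Section Dot2.
Context {R : realType} {H : hilbertType R}.
Local Notation C := R[i].

Lemma dot2_bilinear :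
  bilinear_for (@GRing.mul C) (@Num.conj C \; *%R) (@dot2 R H).
Proof.
split=> [y a x1 x2|x a y1 y2]; rewrite /dot2 /=.
  by rewrite !linearDl !linearZl_LR /= mulrDr addrACA.
by rewrite !linearDr !linearZr_LR /= mulrDr addrACA.
Qed.

HB.instance Definition _ := bilinear_isBilinear.Build C (H * H)%type
  (H * H)%type C *%R (@Num.conj C \; *%R) (@dot2 R H) dot2_bilinear.

Lemma dot2_hermitian (x y : H * H) : dot2 x y = (-1) ^+ false * (dot2 y x)^*.
Proof. by rewrite expr0 mul1r /dot2 rmorphD /= -!dot_conjC. Qed.

HB.instance Definition _ := isHermitianSesquilinear.Build C (H * H)%type
  false (@Num.conj C) (@dot2 R H) dot2_hermitian.

Lemma dot2_posdef (x : H * H) : x != 0 -> 0 < dot2 x x.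
Proof.
case: x => x1 x2; rewrite xpair_eqE negb_and /dot2 /= => /orP[x0|x0].
  by rewrite ltr_pwDl ?dnorm_gt0 ?dnorm_ge0.
by rewrite ltr_wpDl ?dnorm_gt0 ?dnorm_ge0.
Qed.

HB.instance Definition _ := isDotProduct.Build C (H * H)%type
  (@dot2 R H) dot2_posdef.

Lemma sqr_norm_le_dot2 (x : H * H) : `|x| ^+ 2 <= dot2 x x.
Proof.
rewrite /dot2 -!sqr_norm_dot prod_normE.
have [_|_] := real_leP (normr_real x.1) (normr_real x.2).
  by rewrite lerDr exprn_ge0.
by rewrite lerDl exprn_ge0.
Qed.

Lemma dot2_le_sqr_norm (x : H * H) : dot2 x x <= 2 * `|x| ^+ 2.
Proof.
have [x1 x2] : `|x.1| <= `|x| /\ `|x.2| <= `|x|.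
  rewrite prod_normE.
  by have [|/ltW] := real_leP (normr_real x.1) (normr_real x.2); split.
rewrite /dot2 -!sqr_norm_dot mulr_natl mulr2n.
by rewrite lerD // ler_pXn2r ?nnegrE.
Qed.

End Dot2.

(** * The symplectic form and adjoints *)

Section Symplectic.
Context {R : realType}.
Local Notation C := R[i].
Implicit Type H : hilbertType R.

Definition sympl {H} (x y : H * H) : C := dot x.2 y.1 - dot x.1 y.2.

Lemma kreinE H (x y : H * H) : krein x y = - 'i * sympl x y.
Proof. by rewrite /krein /dot2 /= !linearZl_LR /= /sympl; ring. Qed.

Lemma sympl_conjC H (x y : H * H) : sympl y x = - (sympl x y)^*.
Proof. by rewrite /sympl rmorphB /= -!dot_conjC opprB. Qed.

Lemma sympl_eq0C H (x y : H * H) : sympl x y = 0 -> sympl y x = 0.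
Proof. by move=> xy; rewrite sympl_conjC xy conjC0 oppr0. Qed.

Lemma sympl_dot2 H (x y : H * H) : sympl x y = dot2 x (- y.2, y.1).
Proof. by rewrite /sympl /dot2 /= linearNr addrC. Qed.

Lemma dot2_sympl H (x y : H * H) : dot2 x y = sympl x (y.2, - y.1).
Proof. by rewrite sympl_dot2 /= opprK -surjective_pairing. Qed.

Lemma sympl_nondegenerate H (y : H * H) : (forall x, sympl x y = 0) -> y = 0.
Proof.
move=> y0; have /eqP := y0 (- y.2, y.1).
rewrite sympl_dot2 dnorm_eq0 xpair_eqE oppr_eq0 => /andP[/eqP y2 /eqP y1].
by rewrite [y]surjective_pairing y1 y2.
Qed.

Lemma adjP H (T : set (H * H)) y : adj T y <-> forall x, T x -> sympl x y = 0.
Proof.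
by split=> Ty x Tx; [rewrite /sympl (Ty x Tx) subrr|apply: subr0_eq; exact: Ty].
Qed.

Lemma adjS H (T U : set (H * H)) : T `<=` U -> adj U `<=` adj T.
Proof. by move=> TU y Uy x /TU; exact: Uy. Qed.

Lemma adj_closure H (T : set (H * H)) : adj T `<=` adj (closure T).
Proof.
move=> y /adjP Ty; apply/adjP => x.
suff: closure T `<=` [set x | dot2 x (- y.2, y.1) = 0].
  by move=> /[apply] /=; rewrite sympl_dot2.
rewrite closureE; apply: smallest_sub => [|z /Ty]; last first.
  by rewrite /= sympl_dot2.
exact: (closed_orthogonal (ler0n _ _) (@dot2_le_sqr_norm _ _)).
Qed.

(** The adjoint of [T] is the orthogonal complement of [T] for [dot2], rotated by
    [(w, w') |-> (w', - w)]; the rotation cancels in the second adjoint, so a point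
    of it outside the closure would contradict orthogonal separation. *)
Lemma biadjoint_sub_closure H (T : set (H * H)) :
  linear_subspace T -> adj (adj T) `<=` closure T.
Proof.
move=> Tlin v /adjP Tv; apply: contrapT => nTv.
have [w [Tw /eqP]] := @orthogonal_separation R (H * H)%type (@dot2 R H) 2
  (ler0n _ 2) (@sqr_norm_le_dot2 R H) (@dot2_le_sqr_norm R H) _ _ Tlin nTv.
apply; rewrite [LHS]dot2_sympl; apply/sympl_eq0C/Tv/adjP => x /Tw.
by rewrite [X in X = _ -> _]dot2_sympl.
Qed.

End Symplectic.

(** * Unitary and boundary relations as self-orthogonal subspaces *)

Section Lagrangian.
Context {R : realType}.
Implicit Type H K : hilbertType R.

(** Self-orthogonality in [(H * H) * (K * K)] for the difference of the two
    symplectic forms; the second condition is [green_identity] with its two sides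
    folded. *)
Definition lagrangian {H K} (W : set ((H * H) * (K * K))) : Prop :=
  linear_relation W /\
  forall y, W y <-> forall x, W x -> sympl x.1 y.1 = sympl x.2 y.2.

Lemma unitary_lagrangian H K (W : set ((H * H) * (K * K))) :
  unitary_relation W <-> lagrangian W.
Proof.
have kreinI (L M : hilbertType R) (f h : L * L) (g k : M * M) :
    krein g k = krein f h <-> sympl f h = sympl g k.
  rewrite !kreinE; split=> [/mulfI|->//].
  by rewrite oppr_eq0 neq0Ci => /(_ isT).
split=> -[Wlin WE]; split=> //.
  move=> [h k]; have /= -> : W (h, k) = rel_adjoint krein krein W (k, h).
    by rewrite -WE.
  by split=> Wx x /Wx /kreinI.
apply/seteqP; split=> -[k h] /=.
  by move=> /WE Wx x /Wx /kreinI.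
by move=> Wx; apply/WE => x /Wx /kreinI.
Qed.

Lemma boundary_lagrangian H K S (G : set ((H * H) * (K * K))) :
  boundary_relation S G <->
  [/\ lagrangian G, rel_dom G `<=` adj S & adj S `<=` closure (rel_dom G)].
Proof.
split=> [[Glin domG denseG Giso Gmax]|[[Glin GE] domG denseG]].
  by split=> //; split=> // y; split=> [Gy x Gx|/Gmax//]; apply: Giso.
split=> // [x y Gx /GE|y Gy]; first exact.
exact/GE.
Qed.

End Lagrangian.

(** * Composition with an ordinary boundary triplet *)

Section Triplet.
Context {R : realType} {H K : hilbertType R} {S : set (H * H)}.
Context {G0 G1 : H * H -> K}.
Hypothesis S_closed_symmetric : closed_symmetric S.
Hypothesis G_triplet : ordinary_boundary_triplet S G0 G1.
Local Notation Gamma f := (G0 f, G1 f).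

Lemma biadjoint_closed : adj (adj S) `<=` S.
Proof.
have [Slin Scl _] := S_closed_symmetric.
by move=> y /(biadjoint_sub_closure Slin); rewrite -((closure_id S).1 Scl).
Qed.

Lemma sub_adj : S `<=` adj S.
Proof. by have [] := S_closed_symmetric. Qed.

Lemma triplet_sympl f g : adj S f -> adj S g ->
  sympl f g = sympl (Gamma f) (Gamma g).
Proof. exact: triplet_green. Qed.

Lemma triplet_surj h : exists2 f, adj S f & Gamma f = h.
Proof. exact: triplet_onto. Qed.

Lemma adj_linear : linear_subspace (adj S).
Proof.
split; first by apply/adjP => x _; rewrite /sympl /= !linear0r subrr.
move=> a x y /adjP Sx /adjP Sy; apply/adjP => z Sz.
have sD : sympl z (a *: x + y) = a^* * sympl z x + sympl z y.
  by rewrite /sympl /= !linearDr /= !linearZr_LR /=; ring.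
by rewrite sD Sx// Sy// mulr0 addr0.
Qed.

Lemma triplet_linear a x y : adj S x -> adj S y ->
  Gamma (a *: x + y) = a *: Gamma x + Gamma y.
Proof.
move=> Sx Sy.
by rewrite (triplet_linear0 G_triplet)// (triplet_linear1 G_triplet).
Qed.

(** Both inclusions compare orthogonality in [S^*] with orthogonality in the range:
    [Gamma f = 0] makes [f] orthogonal to all of [S^*], that is [f] in [S^**];
    conversely an [f] in [S] is orthogonal to [S^*], so [Gamma f] is orthogonal to
    the whole range, where the form is nondegenerate. *)
Lemma triplet_ker f : adj S f -> (Gamma f = 0 <-> S f).
Proof.
move=> adjf; split=> [f0|Sf].
  apply/biadjoint_closed/adjP => g adjg.
  by rewrite triplet_sympl// f0 /sympl /= !linear0r subrr.
apply: sympl_nondegenerate => h; have [g adjg <-] := triplet_surj h.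
rewrite -triplet_sympl//; apply: sympl_eq0C.
by move/adjP : adjg; apply.
Qed.

Lemma triplet_relE (L : hilbertType R) (W : set ((K * K) * (L * L))) f l :
  (W \; triplet_rel S G0 G1)%relation (f, l) <-> adj S f /\ W (Gamma f, l).
Proof. by split=> [[_ [adjf /= ->] Wl]|[adjf Wl]] //; exists (Gamma f). Qed.

Lemma triplet_rel_inj (L : hilbertType R) (W1 W2 : set ((K * K) * (L * L))) :
  (W1 \; triplet_rel S G0 G1)%relation = (W2 \; triplet_rel S G0 G1)%relation ->
  W1 `<=` W2.
Proof.
move=> W12 [h l] W1hl; have [f adjf fh] := triplet_surj h.
have : (W1 \; triplet_rel S G0 G1)%relation (f, l).
  by apply/triplet_relE; rewrite fh.
by rewrite W12 => /triplet_relE[_]; rewrite fh.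
Qed.

Lemma triplet0 : Gamma 0 = 0.
Proof.
by apply/triplet_ker; [exact: adj_linear.1|have [[]] := S_closed_symmetric].
Qed.

(** Maximality of the composition: since [S * {0}] lies in it, a pair [(g, m)]
    orthogonal to it has [g] in [S^*], so that [Gamma g] is defined and
    [(Gamma g, m)] can be tested against [W]. *)
Lemma lagrangian_comp (L : hilbertType R) (W : set ((K * K) * (L * L))) :
  lagrangian W -> lagrangian (W \; triplet_rel S G0 G1)%relation.
Proof.
move=> [[W0 Wlin] WE]; have [adj0 _] := adj_linear; split.
  split.
    rewrite -[0]/(0, 0).
    by apply/triplet_relE; rewrite triplet0.
  move=> a [f l] [g m] /triplet_relE[adjf Wf] /triplet_relE[adjg Wg].
  apply/triplet_relE; split; first exact: adj_linear.2.
  by rewrite triplet_linear//; apply: Wlin Wf Wg.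
move=> [g m]; split=> [/triplet_relE[adjg /WE Wg]|Gg].
  move=> [f l] /triplet_relE[adjf Wf].
  by rewrite [LHS]triplet_sympl//; exact: Wg Wf.
have adjg : adj S g.
  apply/adjP => f Sf.
  have adjf := sub_adj Sf.
  rewrite [LHS](Gg (f, 0)) /sympl /= ?linear0l ?subrr//.
  by apply/triplet_relE; rewrite ((triplet_ker adjf).2 Sf).
apply/triplet_relE; split=> //; apply/WE => -[h l] Wh /=.
have [f adjf fh] := triplet_surj h.
rewrite -fh -triplet_sympl//; apply: (Gg (f, l)).
by apply/triplet_relE; rewrite fh.
Qed.

Lemma boundary_comp (L : hilbertType R) (W : set ((K * K) * (L * L))) :
  lagrangian W -> rel_ker W = [set 0] ->
  boundary_relation S (W \; triplet_rel S G0 G1)%relation.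
Proof.
move=> Wlag Wker; have Glag := lagrangian_comp Wlag.
have [[[W0 Wlin] WE] [Glin _]] := (Wlag, Glag).
set T := rel_dom (W \; triplet_rel S G0 G1)%relation.
have TE f : T f <-> exists l, adj S f /\ W (Gamma f, l).
  split=> [[[f' l] /triplet_relE fl /= <-]|[l /triplet_relE fl]].
    by exists l.
  by exists (f, l).
have Tlin : linear_subspace T.
  split; first by exists 0 => //; apply: Glin.1.
  move=> a _ _ [x Gx <-] [y Gy <-]; exists (a *: x + y) => //; exact: Glin.2.
have ST : S `<=` T.
  move=> f Sf; have adjf := sub_adj Sf; apply/TE; exists 0; split=> //.
  by rewrite ((triplet_ker adjf).2 Sf).
(* This is where the trivial kernel of [W] enters. *)
have adjTS : adj T `<=` S.
  move=> g Tg; have adjg := adjS ST Tg; apply/triplet_ker => //.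
  suff : rel_ker W (Gamma g) by rewrite Wker.
  apply/WE => -[h l] Wh /=; have [f adjf fh] := triplet_surj h.
  rewrite -fh -triplet_sympl// [RHS]/sympl /= !linear0r subrr.
  by move/adjP : Tg; apply; apply/TE; exists l; rewrite fh.
apply/boundary_lagrangian; split=> //.
  by move=> f /TE[l []].
exact: subset_trans (adjS adjTS) (biadjoint_sub_closure Tlin).
Qed.

(** The factor is [W = G2 Gamma^-1]. It loses nothing, because [G2] contains
    [ker Gamma * {0} = S * {0}] by maximality. *)
Lemma boundary_factor (L : hilbertType R) (G2 : set ((H * H) * (L * L))) :
  boundary_relation S G2 ->
  exists W : set ((K * K) * (L * L)),
    [/\ lagrangian W, rel_ker W = [set 0]
      & G2 = (W \; triplet_rel S G0 G1)%relation].
Proof.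
move=> /boundary_lagrangian[[[G20 G2lin] G2E] domG2 denseG2].
have adjG2 f l : G2 (f, l) -> adj S f.
  by move=> G2f; apply: domG2; exists (f, l).
have SG2 f : S f -> G2 (f, 0).
  move=> Sf; apply/G2E => -[g l] /adjG2 /adjP adjg /=.
  rewrite [RHS]/sympl /= !linear0r subrr; exact/sympl_eq0C/adjg.
pose W := [set hl : (K * K) * (L * L) |
  exists2 f, G2 (f, hl.2) & Gamma f = hl.1].
have WE f l : adj S f -> W (Gamma f, l) -> G2 (f, l).
  move=> adjf [g /= G2g gf]; have adjg := adjG2 _ _ G2g.
  have SB : S (f - g).
    have adjfg : adj S (f - g) by rewrite addrC -scaleN1r; apply: adj_linear.2.
    apply/triplet_ker => //; rewrite addrC -scaleN1r triplet_linear// gf.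
    by rewrite scaleN1r addNr.
  have -> : (f, l) = 1 *: (g, l) + (f - g, 0).
    by rewrite scale1r; congr pair; rewrite /= ?addr0// addrC subrK.
  exact: G2lin G2g (SG2 _ SB).
exists W; split.
- split.
    split; first by exists 0; [exact: G20|exact: triplet0].
    move=> a [h l] [k m] [f /= G2f <-] [g /= G2g <-].
    exists (a *: f + g); first exact: (G2lin a (f, l) (g, m)).
    by rewrite triplet_linear//; [exact: adjG2 G2f|exact: adjG2 G2g].
  move=> [h m]; split=> [[g G2g /= <-] [h' l] [f G2f /= <-] |Wh].
    rewrite -triplet_sympl; [|exact: adjG2 G2f|exact: adjG2 G2g].
    by move/G2E : G2g => /(_ _ G2f).
  have [g adjg gh] := triplet_surj h; exists g => //.
  apply/G2E => -[f l] G2f /=.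
  rewrite triplet_sympl ?gh//; last exact: adjG2 G2f.
  by apply: (Wh (Gamma f, l)); exists f.
- apply/seteqP; split=> [h [f /= G2f <-]|h ->] /=; last first.
    by exists 0; [exact: G20|exact: triplet0].
  have adjf := adjG2 _ _ G2f; apply/triplet_ker => //.
  apply/biadjoint_closed/(adjS denseG2)/adj_closure/adjP => _ [[g l] G2g <-] /=.
  by move/G2E : G2f => /(_ _ G2g) /= ->; rewrite /sympl /= !linear0r subrr.
- apply/seteqP; split=> -[f l] => [G2f|/triplet_relE[adjf /WE]]; last exact.
  by apply/triplet_relE; split; [exact: adjG2 G2f|exists f].
Qed.

End Triplet.

(** * The correspondence *)

Unset Implicit Arguments.

Theorem proposition4p4 (R : realType) (H K : hilbertType R) (S : set (H * H))
    (S_closed_symmetric : closed_symmetric S)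
    (S_defect : equal_defect_numbers S)
    (G0 G1 : H * H -> K)
    (G_triplet : ordinary_boundary_triplet S G0 G1) :
  [/\ forall (L : hilbertType R) (W : set ((K * K) * (L * L))),
        unitary_relation W -> rel_ker W = [set 0] ->
        boundary_relation S (W \; triplet_rel S G0 G1)%relation,
      forall (L : hilbertType R) (G2 : set ((H * H) * (L * L))),
        boundary_relation S G2 ->
        exists W : set ((K * K) * (L * L)),
          [/\ unitary_relation W, rel_ker W = [set 0]
            & G2 = (W \; triplet_rel S G0 G1)%relation]
    & set_bij
        [set W : set ((K * K) * (K * K)) |
          unitary_relation W /\ rel_ker W = [set 0]]
        [set G2 : set ((H * H) * (K * K)) | boundary_relation S G2]
        (fun W => (W \; triplet_rel S G0 G1)%relation)].
Proof.
have direct (L : hilbertType R) (W : set ((K * K) * (L * L))) :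
    unitary_relation W -> rel_ker W = [set 0] ->
    boundary_relation S (W \; triplet_rel S G0 G1)%relation.
  by move=> /unitary_lagrangian; exact: boundary_comp.
have converse (L : hilbertType R) (G2 : set ((H * H) * (L * L))) :
    boundary_relation S G2 ->
    exists W : set ((K * K) * (L * L)),
      [/\ unitary_relation W, rel_ker W = [set 0]
        & G2 = (W \; triplet_rel S G0 G1)%relation].
  move=> /(boundary_factor S_closed_symmetric G_triplet)[W [Wlag Wker ->]].
  by exists W; split=> //; apply/unitary_lagrangian.
split=> //; split.
- by move=> W [/direct].
- move=> W1 W2 _ _ W12; apply/seteqP.
  by split; apply: (triplet_rel_inj G_triplet).
- by move=> G2 /converse[W [Wu Wker ->]]; exists W.
Qed.
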